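(* Let $k\ge 3$ be an integer and, for positive integers $m$, let $T(k,m)=\frac{(k-2)m(m-1)}{2}+m$ be the $m$-th $k$-gonal number. For a positive integer $n$ put $s=\left\lfloor\sqrt{\frac{2n}{k-2}}\right\rfloor$. Then the $n$-th smallest positive integer not of the form $T(k,m)$ ($m\ge 1$) equals $$a(n)=\begin{cases} n+s+1 & \text{if } 2n>(k-2)s(s+1),\\ n+s & \text{otherwise.}\end{cases}$$ Moreover, for $3\le k\le 10$ this equals $n+\left\lfloor\sqrt{\frac{2n}{k-2}}+\frac{1}{2}\right\rfloor$. *)

(* Defs.v *)
From mathcomp Require Import all_boot all_order all_algebra.
From mathcomp Require Import all_classical all_reals.
From mathcomp Require Import finmap.
Set Implicit Arguments.
Unset Strict Implicit.
Unset Printing Implicit Defensive.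

Import Order.TTheory GRing.Theory Num.Theory.
Local Open Scope classical_set_scope.
Local Open Scope nat_scope.

(* The division is exact because m * (m - 1) is even; the truncated
   subtractions agree with those of the integers when 2 <= k and 1 <= m. *)
Definition polygonal (k m : nat) : nat := (k - 2) * m * (m - 1) %/ 2 + m.

Definition nonpolygonal (k : nat) : set nat :=
  [set x | 0 < x /\ ~ exists2 m, 1 <= m & x = polygonal k m].

(* Ranks start at 1: x is an element of A and exactly n elements of A, itself
   included, are at most x. *)
Definition nth_smallest (A : set nat) (n x : nat) : Prop :=
  A x /\ (A `&` [set y | y <= x] #= `I_n)%card.

Lemma nth_smallest_unique (A : set nat) (n x y : nat) :
  nth_smallest A n x -> nth_smallest A n y -> x = y.
Proof.
wlog ltxy : x y / x < y => [W hx hy|[Ax cx] [Ay cy]].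
  by case: (ltngtP x y) => // lt; [exact: W | exact/esym/W].
have fin z : finite_set (A `&` [set t | t <= z]).
  by apply: (@sub_finite_set _ _ `I_z.+1); [move=> t [] | exact: finite_II].
suff : #|` fset_set (A `&` [set z | z <= x])|
       < #|` fset_set (A `&` [set z | z <= y])|.
  by rewrite (card_fset_set cx) (card_fset_set cy) ltnn.
apply: fproper_ltn_card; rewrite fproperE; apply/andP; split.
  apply/fsubsetP => z; rewrite !in_fset_set // => /set_mem[Az zx].
  by apply/mem_set; split=> //; exact: leq_trans zx (ltnW ltxy).
apply/fsubsetPn; exists y; rewrite in_fset_set //; first by apply/mem_set; split=> /=.
by apply/negP => /set_mem[_ /=]; rewrite leqNgt ltxy.
Qed.

(* Main.v *)
(* If [f j < n + j < f (j + 1)] for a strictly increasing [f] with [f 0 = 0], then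
   exactly [j] of the numbers [1, ..., n + j] are values of [f] at positive
   arguments, so [n + j] is the [n]-th positive integer that is not such a value.
   For the polygonal numbers, with [d = k - 2], the condition on [j] is
   [d j (j - 1) < 2 n <= d j (j + 1)], and [d s^2 <= 2 n < d (s + 1)^2] leaves only
   [j = s] and [j = s + 1].  The rounding formula asks instead that
   [d (j - 1/2)^2 <= 2 n < d (j + 1/2)^2]; since [d j (j - 1)] is even, the strict
   lower bound gives [d j (j - 1) + 2 <= 2 n], which suffices when [d / 4 <= 2]. *)
Require Import Defs.
From mathcomp Require Import all_boot all_order all_algebra.
From mathcomp Require Import all_classical all_reals.
From mathcomp Require Import finmap zify ring lra.
Import Order.TTheory GRing.Theory Num.Theory.
Local Open Scope ring_scope.

Lemma nth_smallest_nonvalue (f : nat -> nat) (n j : nat) :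
  f 0%N = 0%N -> {mono f : m m' / (m <= m')%N} ->
  (f j < n + j < f j.+1)%N ->
  nth_smallest [set x | (0 < x)%N /\ ~ exists2 m, (1 <= m)%N & x = f m]%classic
    n (n + j).
Proof.
move=> f0 fM /andP[fj_lt lt_fj].
(* The window around [n + j] turns comparison of values into comparison of arguments. *)
have fj m : (f m <= n + j)%N = (m <= j)%N.
  apply/idP/idP => [fm|mj]; last first.
    by apply: leq_trans (ltnW fj_lt); rewrite fM.
  by rewrite -ltnS -(leqW_mono fM); exact: leq_ltn_trans fm lt_fj.
split; first split=> [|[m _ E]].
- exact: leq_ltn_trans fj_lt.
- have mj : (m <= j)%N by rewrite -fj -E.
  by move: fj_lt; rewrite E ltnNge fM mj.
(* [V] holds the [j] distinct values [f 1, ..., f j], all within [1, ..., n + j], so its complement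
   [F] there has [n] elements. *)
pose V := [fset x in [seq f m | m <- iota 1 j]]%fset.
pose F := ([fset x in iota 1 (n + j)] `\` V)%fset.
suff -> : ([set x | (0 < x)%N /\ ~ exists2 m, (1 <= m)%N & x = f m]
    `&` [set y | (y <= n + j)%N] = [set` F])%classic.
  apply/card_eq_fsetP; rewrite cardfsDS; last first.
    apply/fsubsetP => x; rewrite !inE /= => /mapP[m]; rewrite !mem_iota => mj ->.
    have := leqW_mono fM 0%N m; have := fj m; rewrite f0; lia.
  rewrite !card_fseq !undup_id ?iota_uniq ?map_inj_uniq ?iota_uniq //.
    by rewrite size_map !size_iota addnK.
  exact: incn_inj fM.
apply/seteqP; split=> x /=; rewrite !inE /= mem_iota.
  move=> [[x0 Nx] xle]; apply/andP; split; last by lia.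
  by apply/mapP => -[m]; rewrite mem_iota => /andP[m0 _] E; apply: Nx; exists m.
move=> /andP[/mapP Nx xle]; split; last by lia.
split=> [|[m m0 E]]; first by lia.
by apply: Nx; exists m => //; rewrite mem_iota m0 add1n ltnS -fj -E; lia.
Qed.

Lemma dvdn2_mul_pred (d m : nat) : (2 %| d * m * (m - 1))%N.
Proof.
by rewrite -mulnA dvdn_mull // dvdn2 oddM; case: m => // m; rewrite subn1 /= andNb.
Qed.

(** Doubling removes the truncated division and leaves polynomial inequalities for [nia]. *)
Lemma double_polygonal (k m : nat) :
  (polygonal k m * 2 = (k - 2) * m * (m - 1) + m * 2)%N.
Proof. by rewrite /polygonal mulnDl divnK // dvdn2_mul_pred. Qed.

Lemma polygonal_mono (k : nat) : {mono polygonal k : m m' / (m <= m')%N}.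
Proof.
apply: leq_mono; apply: homo_ltn => [y x z|m]; first exact: ltn_trans.
have := double_polygonal k m; have := double_polygonal k m.+1.
rewrite subn1 /=; case: m => [|m]; rewrite ?subn1 /=; nia.
Qed.

Lemma nth_smallest_nonpolygonal (k n j : nat) :
  ((k - 2) * j * (j - 1) < 2 * n <= (k - 2) * j * (j + 1))%N ->
  nth_smallest (nonpolygonal k) n (n + j).
Proof.
move=> /andP[lo hi]; apply: nth_smallest_nonvalue.
- by rewrite /polygonal muln0.
- exact: polygonal_mono.
have := double_polygonal k j; have := double_polygonal k j.+1.
rewrite subn1 /= => e1 e2; apply/andP; split; nia.
Qed.

Lemma truncn_sqrt_bounds (R : realType) (d n s : nat) :
  (0 < d)%N -> s = Num.truncn (Num.sqrt (2 * n%:R / d%:R) : R) ->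
  (d * s * s <= 2 * n < d * s.+1 * s.+1)%N.
Proof.
set r : R := Num.sqrt _ => d0 sE.
have dR : (0 : R) < d%:R by rewrite ltr0n.
have r0 : 0 <= r by exact: sqrtr_ge0.
have r2 : d%:R * r ^+ 2 = 2 * n%:R :> R.
  by rewrite sqr_sqrtr ?divr_ge0 ?mulr_ge0 // mulrC divfK // gt_eqF.
have /andP[sr rs] := truncn_itv r0; rewrite -sE in sr rs.
rewrite -(ler_nat R) -(ltr_nat R) !natrM -r2 -!mulrA -!expr2.
by rewrite ler_pM2l // ltr_pM2l // lerXn2r ?nnegrE // ltrXn2r ?nnegrE.
Qed.

Lemma truncn_sqrt_half (R : realType) (d n j : nat) :
  (0 < d <= 8)%N -> (0 < j)%N -> (d * j * (j - 1) < 2 * n <= d * j * (j + 1))%N ->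
  Num.truncn (Num.sqrt (2 * n%:R / d%:R) + 1 / 2 : R) = j.
Proof.
move=> /andP[d0 d8] j0 /andP[lo hi].
(* Moving [d * j] across avoids a truncated subtraction in the cast to [R]. *)
have {}lo : (d * j * j + 2 <= 2 * n + d * j)%N.
  by have := dvdn2_mul_pred d j; case: j j0 lo {hi} => // j _; rewrite subn1 /=; nia.
set r : R := Num.sqrt _.
have dR : (0 : R) < d%:R by rewrite ltr0n.
have r0 : 0 <= r by exact: sqrtr_ge0.
have r2 : d%:R * r ^+ 2 = 2 * n%:R :> R.
  by rewrite sqr_sqrtr ?divr_ge0 ?mulr_ge0 // mulrC divfK // gt_eqF.
have jR : (1 : R) <= j%:R by rewrite ler1n.
rewrite -(ler_nat R) in d8.
rewrite -(ler_nat R) natrD [in leRHS]natrD !natrM -r2 in lo.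
rewrite -(ler_nat R) !natrM natrD -r2 in hi.
apply: truncn_def; rewrite -[j.+1%:R]natr1; apply/andP; split.
  suff : j%:R - 1 / 2 <= r by lra.
  rewrite -ler_sqr ?nnegrE //; last by lra.
  rewrite -(ler_pM2l dR); lra.
(* Strict because [d (j + 1/2)^2] exceeds [d j (j + 1)] by [d / 4 > 0]. *)
suff : r < j%:R + 1 / 2 by lra.
rewrite -ltr_sqr ?nnegrE //; last by lra.
rewrite -(ltr_pM2l dR); lra.
Qed.

Theorem theorem4 (R : realType) (k n : nat) (hk : (3 <= k)%N) (hn : (0 < n)%N) :
  let r : R := Num.sqrt (2 * n%:R / (k%:R - 2)) in
  let s : nat := Num.truncn r in
  let a : nat := if ((k - 2) * s * (s + 1) < 2 * n)%N then (n + s + 1)%N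
                 else (n + s)%N in
  nth_smallest (nonpolygonal k) n a /\
  ((k <= 10)%N -> a = (n + Num.truncn (r + 1 / 2))%N).
Proof.
move=> r s a.
have rE : r = Num.sqrt (2 * n%:R / (k - 2)%:R) by rewrite natrB //; lia.
have d0 : (0 < k - 2)%N by lia.
have := @truncn_sqrt_bounds R (k - 2) n s d0.
rewrite -rE => /(_ erefl) /andP[lo hi].
have [j [j0 jn aE]] : exists j, [/\ (0 < j)%N,
    ((k - 2) * j * (j - 1) < 2 * n <= (k - 2) * j * (j + 1))%N & a = (n + j)%N].
  rewrite /a; case: ltnP => [lt|ge].
    (* The branch condition is the lower bound; the upper one follows from [2 n < d (s + 1)^2]. *)
    exists s.+1; split=> //; last by rewrite addn1 addnS.
    rewrite subn1 /=; apply/andP; split; nia.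
  (* [s = 0] would force [2 n <= 0]; positivity of [s] makes [d s (s - 1) < d s^2] strict. *)
  have s0 : (0 < s)%N by case: (s) ge => //; lia.
  exists s; split=> //; rewrite ge andbT.
  by apply: leq_trans lo; rewrite ltn_mul2l; lia.
rewrite aE; split; first exact: nth_smallest_nonpolygonal.
by move=> k10; rewrite rE (truncn_sqrt_half R _ n j) //; lia.
Qed.
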